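(* Let $m\ge0$ be an integer and let $\alpha>m-1$ be real. As $j\to\infty$, $$-\frac{1}{\alpha+1+j}\,\frac{L^{\mathrm{II}(\alpha)}_{m,m+j}(z)}{L^{(\alpha)}_j(z)}=\eta_{\alpha+1,m}(z)+O(j^{-1/2})$$ uniformly for $z$ in compact subsets of $\mathbb{C}\setminus[0,\infty)$.
   Context: For real $\alpha$ and integer $n\ge 0$, $L^{(\alpha)}_n(z)=\sum_{k=0}^n \binom{n+\alpha}{n-k}\frac{(-z)^k}{k!}$ is the classical Laguerre polynomial (generalized binomial coefficients), and $L^{(\alpha)}_{-1}:=0$. Put $\eta_{\alpha,m}(z)=L^{(-\alpha)}_m(z)$, so that $\eta_{\alpha+1,m}=L^{(-\alpha-1)}_m$, and $A^{\mathrm{II}}_{\alpha,m}[y]=z\,\eta_{\alpha,m}\,y'+(\alpha-m)\,\eta_{\alpha+1,m}\,y$. For integers $m,j\ge0$, the type II exceptional Laguerre polynomial of degree $m+j$ is $L^{\mathrm{II}(\alpha)}_{m,m+j}=-A^{\mathrm{II}}_{\alpha+1,m}\big[L^{(\alpha+1)}_{j}\big]$, i.e. $L^{\mathrm{II}(\alpha)}_{m,m+j}(z)=z\,L^{(-\alpha-1)}_m(z)L^{(\alpha+2)}_{j-1}(z)+(m-\alpha-1)L^{(-\alpha-2)}_m(z)L^{(\alpha+1)}_j(z)$. *)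

(* Defs.v *)
From HB Require Import structures.
From mathcomp Require Import all_boot all_order all_algebra.
From mathcomp Require Import all_classical all_reals all_analysis.
From mathcomp Require Import complex.

Set Implicit Arguments.
Unset Strict Implicit.
Unset Printing Implicit Defensive.

Import Order.TTheory GRing.Theory Num.Theory numFieldNormedType.Exports.
Local Open Scope ring_scope.
Local Open Scope complex_scope.

(* x (x - 1) ... (x - k + 1) / k! *)
Definition gbinom (F : numFieldType) (x : F) (k : nat) : F :=
  (\prod_(i < k) (x - i%:R)) / k`!%:R.

Definition laguerre (F : numFieldType) (a : F) (n : nat) : {poly F} :=
  \sum_(k < n.+1) (gbinom (n%:R + a) (n - k) / k`!%:R) *: (- 'X) ^+ k.

Definition eta_poly (F : numFieldType) (a : F) (m : nat) : {poly F} :=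
  laguerre (- a) m.

Definition opAII (F : numFieldType) (a : F) (m : nat) (y : {poly F}) : {poly F} :=
  'X * eta_poly a m * y^`() + (a - m%:R) *: (eta_poly (a + 1) m * y).

(* The type II exceptional Laguerre polynomial of degree m + j:
   the last argument is j, not the degree. *)
Definition xlaguerreII (F : numFieldType) (a : F) (m j : nat) : {poly F} :=
  - opAII (a + 1) m (laguerre (a + 1) j).

(* Value at a complex point of a polynomial with real coefficients. *)
Definition evalC (R : rcfType) (p : {poly R}) (z : R[i]) : R[i] :=
  (map_poly (real_complex R) p).[z].

(* Main.v *)
Require Import Defs.
From mathcomp Require Import all_boot all_order all_algebra.
From mathcomp Require Import all_classical all_reals all_analysis.
From mathcomp Require Import complex.
From mathcomp Require Import ring.

(* With r_j = L_j^(alpha+1) / L_j^(alpha), the contiguous relations turn the error term into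
   r_j / (alpha + 1 + j) times a fixed polynomial, so it suffices that r_j = O(sqrt j).
   Now r_j = 1 - (L_j^(alpha))' / L_j^(alpha) = 1 + sum_i 1 / (x_i - z), where the zeros x_i are
   nonnegative reals, and off [0, +oo) this sum is dominated by a multiple of
   u = sum_i 1 / (x_i + 1). Evaluating Laguerre's differential equation at -1 gives
   u^2 + (alpha + 2) u = j + sum_i 1 / (x_i + 1)^2 <= j + u, whence u <= sqrt j. *)

Set Implicit Arguments.
Unset Strict Implicit.
Unset Printing Implicit Defensive.

Import Order.TTheory GRing.Theory Num.Theory numFieldNormedType.Exports.
Local Open Scope classical_set_scope.
Local Open Scope ring_scope.
Local Open Scope complex_scope.

(** * Generalized binomial coefficients *)

Lemma mul_gbinom_succ (F : numFieldType) (x : F) (k : nat) :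
  k.+1%:R * gbinom x k.+1 = (x - k%:R) * gbinom x k.
Proof.
have k0 : (k.+1%:R : F) != 0 by rewrite pnatr_eq0.
have f0 : (k`!%:R : F) != 0 by rewrite pnatr_eq0 -lt0n fact_gt0.
rewrite /gbinom big_ord_recr /= factS natrM.
by field; rewrite ?natr1 ?nat1r ?f0 ?k0.
Qed.

Lemma gbinom_absorb (F : numFieldType) (x : F) (k : nat) :
  k.+1%:R * gbinom (x + 1) k.+1 = (x + 1) * gbinom x k.
Proof.
have k0 : (k.+1%:R : F) != 0 by rewrite pnatr_eq0.
rewrite /gbinom big_ord_recl /= subr0 factS natrM.
rewrite (eq_bigr (fun i : 'I_k => x - i%:R)); last first.
  by move=> i _; rewrite /bump leq0n add1n -natr1; ring.
have f0 : (k`!%:R : F) != 0 by rewrite pnatr_eq0 -lt0n fact_gt0.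
by field; rewrite ?natr1 ?nat1r ?f0 ?k0.
Qed.

Lemma gbinom_pascal (F : numFieldType) (x : F) (k : nat) :
  gbinom (x + 1) k.+1 = gbinom x k.+1 + gbinom x k.
Proof.
have k0 : (k.+1%:R : F) != 0 by rewrite pnatr_eq0.
apply: (mulfI k0); rewrite mulrDr gbinom_absorb mul_gbinom_succ.
by rewrite -mulrDl -natr1; congr (_ * _); ring.
Qed.

Lemma gbinom0 (F : numFieldType) (x : F) : gbinom x 0 = 1.
Proof. by rewrite /gbinom big_ord0 fact0 divr1. Qed.

(** * Contiguous relations and the Laguerre equation *)

Lemma coef_laguerre (F : numFieldType) (a : F) (n k : nat) :
  (laguerre a n)`_k =
  if (k <= n)%N then gbinom (n%:R + a) (n - k) / k`!%:R * (-1) ^+ k else 0.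
Proof.
suff -> : laguerre a n = \poly_(i < n.+1)
    (gbinom (n%:R + a) (n - i) / i`!%:R * (-1) ^+ i) by rewrite coef_poly ltnS.
rewrite poly_def; apply: eq_bigr => i _.
by rewrite -scaleN1r exprZn scalerA.
Qed.

Lemma laguerre_pascal (F : numFieldType) (a : F) (n : nat) :
  laguerre (a + 1) n.+1 = laguerre (a + 1) n + laguerre a n.+1.
Proof.
apply/polyP => k; rewrite coefD !coef_laguerre.
have [kn|kn|->] := ltngtP k n.+1.
- rewrite -ltnS kn subSn// addrA gbinom_pascal -natr1.
  rewrite (_ : _ + 1 + a = n%:R + (a + 1)); last by ring.
  by rewrite mulrDl mulrDl addrC.
- by rewrite leqNgt (ltn_trans _ kn) ?add0r.
- by rewrite ltnn add0r subnn !gbinom0.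
Qed.

(** Together with [laguerre_pascal] this carries the pair of parameters [a], [a + 1] from degree [n]
    to [n.+1]; the inductions that locate the zeros run on this pair. *)
Lemma laguerre_step (F : numFieldType) (a : F) (n : nat) :
  n.+1%:R *: laguerre a n.+1 =
  (n.+1%:R + a) *: laguerre a n - 'X * laguerre (a + 1) n.
Proof.
apply/polyP => k; rewrite coefB !coefZ coefXM !coef_laguerre.
have E : n.+1%:R + a = n%:R + a + 1 by rewrite -natr1; ring.
have E' : n%:R + (a + 1) = n%:R + a + 1 by ring.
case: k => [|k] /=.
  by rewrite E !mulr1 fact0 !divr1 subr0 !subn0 gbinom_absorb.
rewrite subSS E E' !ltnS.
have f0 (i : nat) : (i`!%:R : F) != 0 by rewrite pnatr_eq0 -lt0n fact_gt0.
have [kn|kn|->] := ltngtP k n.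
- have := gbinom_absorb (n%:R + a) (n - k.+1).
  rewrite -subSn// subSS => h.
  rewrite [X in _ = X - _]mulrA [X in _ = X * _ - _]mulrA -h factS natrM invfM exprS.
  (* The share [n - k] yields the first term on the right by absorption, the share [k.+1] the term
     with ['X]. *)
  rewrite (_ : n.+1%:R = (n - k)%:R + k.+1%:R); last first.
    by rewrite -natrD addnS subnK// ltnW.
  have k0 : (k.+1%:R : F) != 0 by rewrite pnatr_eq0.
  by field; rewrite ?natr1 ?nat1r ?f0 ?k0.
- by rewrite !mulr0 subrr.
- rewrite subnn !gbinom0 mulr0 factS natrM invfM exprS.
  have k0 : (n.+1%:R : F) != 0 by rewrite pnatr_eq0.
  by field; rewrite ?natr1 ?nat1r ?f0 ?k0.
Qed.

Lemma deriv_laguerreS (F : numFieldType) (a : F) (n : nat) :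
  (laguerre a n.+1)^`() = - laguerre (a + 1) n.
Proof.
apply/polyP => k; rewrite coefN coef_deriv !coef_laguerre ltnS subSS.
case: ifP => kn; last by rewrite mul0rn oppr0.
rewrite (_ : n.+1%:R + a = n%:R + (a + 1)); last by rewrite -natr1; ring.
rewrite factS natrM invfM exprS -[LHS]mulr_natr.
have f0 (i : nat) : (i`!%:R : F) != 0 by rewrite pnatr_eq0 -lt0n fact_gt0.
have k0 : (k.+1%:R : F) != 0 by rewrite pnatr_eq0.
by field; rewrite ?natr1 ?nat1r ?f0 ?k0.
Qed.

Lemma laguerre0 (F : numFieldType) (a : F) : laguerre a 0 = 1.
Proof.
by rewrite /laguerre big_ord1 gbinom0 divr1 scale1r expr0.
Qed.

Lemma deriv_laguerre (F : numFieldType) (a : F) (n : nat) :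
  (laguerre a n)^`() = laguerre a n - laguerre (a + 1) n.
Proof.
case: n => [|n]; first by rewrite !laguerre0 derivC subrr.
by rewrite deriv_laguerreS laguerre_pascal; ring.
Qed.

(** This is [laguerre_step] at [a + 1], its last term read as a derivative, with the degree lowered
    again by [laguerre_pascal]. *)
Lemma mulX_deriv_laguerre (F : numFieldType) (a : F) (n : nat) :
  'X * (laguerre (a + 1) n)^`() =
  (n%:R + a + 1) *: laguerre a n - (a + 1) *: laguerre (a + 1) n.
Proof.
case: n => [|n]; first by rewrite !laguerre0 derivC mulr0 add0r subrr.
have := laguerre_step (a + 1) n; rewrite deriv_laguerreS mulrN => h.
have -> : - ('X * laguerre (a + 1 + 1) n) =
  n.+1%:R *: laguerre (a + 1) n.+1 - (n.+1%:R + (a + 1)) *: laguerre (a + 1) n.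
  by rewrite h [RHS]addrAC subrr add0r.
rewrite laguerre_pascal !scalerDr -!scaleNr -!mul_polyC !(polyCD, polyCN); ring.
Qed.

(** With y and w for the parameters [a] and [a + 1], eliminate w between y' = y - w and X w' = (n +
    a + 1) y - (a + 1) w. *)
Lemma laguerre_ode (F : numFieldType) (a : F) (n : nat) :
  'X * (laguerre a n)^`()^`() + (a + 1)%:P * (laguerre a n)^`()
  - 'X * (laguerre a n)^`() + n%:R%:P * laguerre a n = 0.
Proof.
rewrite [X in 'X * X^`()]deriv_laguerre derivB mulrBr mulX_deriv_laguerre.
rewrite [in X in _ + X - _]deriv_laguerre -!mul_polyC !polyCD; ring.
Qed.

(** * Logarithmic derivatives of split polynomials *)

Lemma horner_deriv_prod_XsubC (F : fieldType) (rs : seq F) (z : F) :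
  z \notin rs ->
  (\prod_(x <- rs) ('X - x%:P))^`().[z] =
  (\prod_(x <- rs) ('X - x%:P)).[z] * \sum_(x <- rs) (z - x)^-1.
Proof.
elim: rs => [|x rs IH]; first by rewrite !big_nil derivC hornerC mulr0.
rewrite inE negb_or -subr_eq0 => /andP[zx /IH h].
rewrite !big_cons derivM derivXsubC !hornerE h.
by field.
Qed.

(** This is P''/P = (P'/P)^2 + (P'/P)', with roots listed with multiplicity. *)
Lemma horner_deriv2_prod_XsubC (F : fieldType) (rs : seq F) (z : F) :
  z \notin rs ->
  (\prod_(x <- rs) ('X - x%:P))^`()^`().[z] =
  (\prod_(x <- rs) ('X - x%:P)).[z] *
  ((\sum_(x <- rs) (z - x)^-1) ^+ 2 - \sum_(x <- rs) (z - x)^-1 ^+ 2).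
Proof.
elim: rs => [|x rs IH].
  by rewrite !big_nil !derivC hornerC expr0n subrr mulr0.
rewrite inE negb_or => /andP[zx zrs]; have h := IH zrs.
have h1 := horner_deriv_prod_XsubC zrs.
rewrite -subr_eq0 in zx.
rewrite !big_cons derivM derivXsubC derivD mul1r derivM derivXsubC mul1r.
rewrite !(hornerXsubC, hornerM, hornerD) h h1.
by field.
Qed.

(** * Location of the zeros *)

(** At [- t] the minus sign in [laguerre_step] turns into a plus, so the recurrences only add
    nonnegative terms. *)
Lemma laguerre_gt0 (C : numFieldType) (a t : C) (n : nat) : -1 < a -> 0 <= t ->
  0 < (laguerre a n).[- t] /\ 0 < (laguerre (a + 1) n).[- t].
Proof.
move=> a1 t0; elim: n => [|n [y0 w0]]; first by rewrite !laguerre0 hornerC ltr01.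
have d0 : 0 < n.+1%:R + a.
  by rewrite -natr1 -addrA ltr_wpDl// addrC -(opprK 1) subr_gt0.
have y'0 : 0 < (laguerre a n.+1).[- t].
  rewrite -(pmulr_rgt0 _ (ltr0Sn C n)) -hornerZ laguerre_step.
  rewrite !(hornerD, hornerN, hornerM, hornerZ, hornerX) mulNr opprK.
  by rewrite ltr_wpDr ?mulr_gt0// mulr_ge0// ltW.
by split=> //; rewrite laguerre_pascal hornerD addr_gt0.
Qed.

(* For non-real z, all the quotients L_n^(a+1)(z) / L_n^(a)(z) stay in the closed half-plane
   of z: this is preserved by the Stieltjes-type recurrence for the quotients. *)
Lemma laguerre_neq0_Im (C : numClosedFieldType) (a z : C) (n : nat) :
  -1 < a -> 'Im z != 0 ->
  (laguerre a n).[z] != 0 /\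
  0 <= 'Im z * 'Im ((laguerre (a + 1) n).[z] * ((laguerre a n).[z])^*).
Proof.
move=> a1 z0; elim: n => [|n]; first by
  rewrite !laguerre0 hornerC oner_eq0 mul1r rmorph1 (Creal_ImP _ (rpred1 _)) mulr0.
have d0 : 0 < n.+1%:R + a.
  by rewrite -natr1 -addrA ltr_wpDl// addrC -(opprK 1) subr_gt0.
have := congr1 (horner^~ z) (laguerre_step a n).
have := congr1 (horner^~ z) (laguerre_pascal a n).
rewrite !(hornerD, hornerN, hornerM, hornerZ, hornerX).
set y := (laguerre a n).[z]; set w := (laguerre (a + 1) n).[z].
set y' := (laguerre a n.+1).[z]; set w' := (laguerre (a + 1) n.+1).[z].
move=> -> E [y0 h].
(* Conjugate the step relation and multiply by [w]: the last term becomes minus the conjugate of [z]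
   times the real number [|w|^2], with imaginary part ['Im z * |w|^2]. *)
have key : n.+1%:R * ('Im z * 'Im (w * y'^*)) =
    (n.+1%:R + a) * ('Im z * 'Im (w * y^*)) + ('Im z * `|w|) ^+ 2.
  have -> : n.+1%:R * ('Im z * 'Im (w * y'^*)) = 'Im z * 'Im (w * (n.+1%:R * y')^*).
    by rewrite rmorphM rmorph_nat (mulrCA w) (ImMl (realn C n.+1)) mulrCA.
  rewrite E rmorphB !rmorphM mulrBr (mulrCA w) (mulrCA w) -normCK.
  have w2 : `|w| ^+ 2 \is Num.real by rewrite rpredX// normr_real.
  rewrite /= (CrealP (gtr0_real d0)) raddfB /= (ImMl (gtr0_real d0)) (ImMr w2) Im_conj.
  by ring.
have Q0 : 0 <= 'Im z * 'Im (w * y'^*).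
  rewrite -(pmulr_rge0 _ (ltr0Sn C n)) key addr_ge0 ?(mulr_ge0 (ltW d0) h)//.
  by rewrite real_exprn_even_ge0// rpredM ?Creal_Im ?normr_real.
split; last first.
  have y2 : 'Im (`|y'| ^+ 2) = 0 by apply/Creal_ImP; rewrite rpredX// normr_real.
  by rewrite mulrDl raddfD /= mulrDr -normCK y2 mulr0 addr0.
(* If [y'] vanished, both nonnegative terms of [key] would vanish, so [w = 0]; the step relation
   would then force [y = 0]. *)
apply/negP => /eqP y'0.
have w0 : w = 0.
  apply/eqP; rewrite -normr_eq0 -(mulrI_eq0 _ (mulfI z0)) -sqrf_eq0.
  rewrite eq_le real_exprn_even_ge0 ?rpredM ?Creal_Im ?normr_real// andbT.
  rewrite -(lerD2l ((n.+1%:R + a) * ('Im z * 'Im (w * y^*)))) -key addr0.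
  by rewrite y'0 rmorph0 mulr0 raddf0 !mulr0 mulr_ge0// ltW.
by move: E; rewrite y'0 w0 !mulr0 subr0 => /esym/eqP; rewrite mulf_eq0 gt_eqF//= (negPf y0).
Qed.

Lemma root_laguerre_ge0 (C : numClosedFieldType) (a x : C) (n : nat) :
  -1 < a -> root (laguerre a n) x -> 0 <= x.
Proof.
move=> a1 /rootP x0.
have xR : x \is Num.real.
  apply/Creal_ImP/eqP; apply: contraT => /(laguerre_neq0_Im n a1)[].
  by rewrite x0 eqxx.
rewrite real_leNgt ?real0//; apply/negP => xlt0.
have [] := @laguerre_gt0 _ a (- x) n a1; first by rewrite oppr_ge0 ltW.
by rewrite opprK x0 ltxx.
Qed.

(** * Square-root growth of the quotient *)

(** The hypothesis on [D] says that 1 / |z - x| is at most D / (x + 1) for every possible zero x, so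
    the estimate of [u], made at [-1], transfers to [z] term by term. *)
Lemma laguerre_quotient_bound (C : numClosedFieldType) (a z D s : C) (n : nat) :
  -1 < a -> (forall x, 0 <= x -> x + 1 <= D * `|z - x|) ->
  0 <= s -> s ^+ 2 = n%:R ->
  (laguerre a n).[z] != 0 /\
  `|(laguerre (a + 1) n).[z] / (laguerre a n).[z]| <= 1 + D * s.
Proof.
move=> a1 hD s0 sn.
have [rs Ers] := closed_field_poly_normal (laguerre a n).
set c := lead_coef _ in Ers; set P := \prod_(x <- rs) _ in Ers.
(* Positivity at [-1] excludes the zero polynomial and later allows division by [c * P.[-1]]. *)
have [L1 _] := laguerre_gt0 n a1 ler01.
have c0 : c != 0.
  by apply: contraTneq L1 => c0; rewrite Ers c0 scale0r horner0 ltxx.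
have rs_ge0 x : x \in rs -> 0 <= x.
  move=> xrs; apply: (@root_laguerre_ge0 _ a x n a1).
  by rewrite Ers rootZ// root_prod_XsubC.
have zx x : 0 <= x -> z - x != 0.
  move=> x0; apply: contraTneq (hD x x0) => ->.
  by rewrite normr0 mulr0 lt_geF// ltr_wpDl.
have zrs : z \notin rs.
  by apply/negP => /[dup]/rs_ge0/zx/[swap] _; rewrite subrr eqxx.
have m1rs : -1 \notin rs by apply/negP => /rs_ge0; rewrite lt_geF ?ltrN10.
have Lz : (laguerre a n).[z] != 0.
  by rewrite -/(root _ z) Ers rootZ// root_prod_XsubC.
split=> //.
pose u := \sum_(x <- rs) (x + 1)^-1.
have x1_gt0 x : x \in rs -> 0 < x + 1 by move=> /rs_ge0 x0; rewrite ltr_wpDl.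
have u_ge0 : 0 <= u.
  by rewrite /u big_seq sumr_ge0// => x /x1_gt0 x0; rewrite invr_ge0 ltW.
have us : u <= s.
  rewrite -(@ler_pXn2r _ 2) ?nnegrE// sn.
  have := congr1 (horner^~ (-1)) (laguerre_ode a n).
  rewrite Ers !(derivZ, hornerD, hornerN, hornerM, hornerX, hornerC, hornerZ).
  rewrite horner_deriv_prod_XsubC// horner_deriv2_prod_XsubC// -/P.
  have -> : \sum_(x <- rs) (-1 - x)^-1 = - u.
    by rewrite /u -sumrN; apply: eq_bigr => x _; rewrite -opprD addrC invrN.
  set v := \sum_(x <- rs) _ => E.
  have vu : v <= u.
    rewrite /u /v !big_seq ler_sum// => x xrs.
    rewrite -opprD addrC invrN sqrrN expr2 ler_piMl ?invr_ge0 ?(ltW (x1_gt0 _ xrs))//.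
    by rewrite invf_le1 ?x1_gt0// lerDr rs_ge0.
  have cP : c * P.[-1] != 0 by rewrite -hornerZ -Ers gt_eqF.
  have {}E : u ^+ 2 + u * (a + 2) = n%:R + v.
    apply: (mulfI cP); apply/eqP; rewrite -subr_eq0 -oppr_eq0; apply/eqP.
    by rewrite -[RHS]E; ring.
  (* After cancelling [u ^+ 2] it remains to see v <= u <= u (a + 2), where [a + 2] exceeds 1. *)
  rewrite -(lerD2r v) -E lerD2l; apply: (le_trans vu).
  rewrite ler_peMr//.
  rewrite (_ : a + 2 = (a + 1) + 1); last by ring.
  by rewrite lerDr -lerBlDr sub0r ltW.
have -> : (laguerre (a + 1) n).[z] / (laguerre a n).[z]
    = 1 - \sum_(x <- rs) (z - x)^-1.
  have -> : (laguerre (a + 1) n).[z] = (laguerre a n).[z] - (laguerre a n)^`().[z].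
    by rewrite deriv_laguerre hornerD hornerN; ring.
  rewrite mulrBl divff//; congr (_ - _).
  rewrite [in LHS]Ers derivZ !hornerZ horner_deriv_prod_XsubC// -/P.
  rewrite Ers hornerZ in Lz.
  by rewrite [c * (_ * _)]mulrA mulrAC divff// mul1r.
apply: (le_trans (ler_normB _ _)); rewrite normr1 lerD2l.
apply: (le_trans (ler_norm_sum _ _ _)).
have D0 : 0 <= D.
  have := hD 0 (lexx _); rewrite add0r => h.
  have : 0 < D * `|z - 0| by exact: lt_le_trans h.
  by rewrite pmulr_lgt0 ?normr_gt0 ?zx// => /ltW.
apply: le_trans (ler_wpM2l D0 us).
rewrite /u mulr_sumr !big_seq ler_sum// => x xrs.
rewrite normfV -[leLHS]mul1r ler_pdivrMr ?normr_gt0 ?zx ?rs_ge0//.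
by rewrite mulrAC ler_pdivlMr ?x1_gt0// mul1r hD// rs_ge0.
Qed.

(** * Complex coefficients and the exceptional polynomial *)

Lemma map_laguerre (F G : numFieldType) (f : {rmorphism F -> G}) (a : F) (n : nat) :
  map_poly f (laguerre a n) = laguerre (f a) n.
Proof.
apply/polyP => k; rewrite coef_map !coef_laguerre /=; case: ifP => _; last exact: rmorph0.
rewrite rmorphM rmorphXn rmorphN1 fmorph_div rmorph_nat /gbinom fmorph_div rmorph_nat.
rewrite rmorph_prod; congr (_ / _ / _ * _); apply: eq_bigr => i _.
by rewrite rmorphB rmorphD !rmorph_nat.
Qed.

(** With the derivative eliminated, the last term is exactly the main term of the asymptotics, and
    the cofactor of [laguerre (a + 1) j] does not depend on [j]. *)
Lemma xlaguerreII_eq (F : numFieldType) (a : F) (m j : nat) :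
  xlaguerreII a m j =
  laguerre (a + 1) j * ((a + 1) *: eta_poly (a + 1) m
                        - (a + 1 - m%:R) *: eta_poly (a + 1 + 1) m)
  - (a + 1 + j%:R) *: (eta_poly (a + 1) m * laguerre a j).
Proof.
rewrite /xlaguerreII /opAII ['X * _]mulrC -mulrA mulX_deriv_laguerre.
rewrite -!mul_polyC !(polyCD, polyCN); ring.
Qed.

(** * Compact subsets of the slit plane *)

Lemma Re_sub (R : rcfType) (x y : R[i]) :
  complex.Re (x - y) = complex.Re x - complex.Re y.
Proof. by case: x; case: y. Qed.

Lemma lipschitz_continuous_complex (R : realType) (f : R[i]^o -> R) :
  (forall x y : R[i], `|f x - f y|%:C <= `|x - y|) -> continuous f.
Proof.
move=> h x.
apply/(@cvgrPdist_lt _ _ _ (nbhs (x : R[i]^o)) (nbhs_filter (x : R[i]^o))) => e e0.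
apply/nbhs_ballP; exists e%:C; first by rewrite /= ltcR.
by move=> y /= xy; rewrite -ltcR (le_lt_trans (h _ _)).
Qed.

(** The continuous function |z| - Re z is nonnegative and vanishes only on [0, +oo), so it has a
    positive minimum [d] on a nonempty [K]. *)
Lemma compact_slit_plane_bounds (R : realType) (K : set R[i]^o) :
  compact K -> K `<=` ~` [set x%:C | x in `[(0 : R), +oo[] ->
  exists B D : R, forall z : R[i], K z -> `|z| <= B%:C /\
    forall x : R[i], 0 <= x -> x + 1 <= D%:C * `|z - x|.
Proof.
move=> cK hK.
have [->|K0] := eqVneq K set0; first by exists 0, 0.
have {}K0 : K !=set0 by apply/set0P.
have nmc : continuous ((fun z => complex.Re `|z|) : R[i]^o -> R).
  apply: lipschitz_continuous_complex => x y.
  by rewrite -Re_sub (le_trans (normc_ge_Re _))// ler_dist_dist.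
have hc : continuous ((fun z => complex.Re `|z| - complex.Re z) : R[i]^o -> R).
  move=> z; apply: (@cvgB _ _ _ _ (nbhs_filter z) _ _ _ _ (nmc z)).
  apply: lipschitz_continuous_complex => x y.
  by rewrite -Re_sub normc_ge_Re.
have [b _ hb] := compact_EVT_max K0 cK (continuous_subspaceT nmc).
have [c cK' hd] := compact_EVT_min K0 cK (continuous_subspaceT hc).
have Rn (z : R[i]) : (complex.Re `|z|)%:C = `|z| by rewrite RRe_real// normr_real.
pose d := complex.Re `|c| - complex.Re c.
have d0 : 0 < d.
  rewrite lt_neqAle subr_ge0 -lecR Rn (le_trans _ (normc_ge_Re _)) ?lecR ?ler_norm// andbT.
  (* Equality |c| = Re c would give Im c = 0 and put [c] on the excluded half-line. *)
  apply/eqP => /esym/eqP; rewrite subr_eq0 => /eqP E.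
  have : ~ [set x%:C | x in `[(0 : R), +oo[] c by apply: hK; apply/set_mem.
  apply; exists (complex.Re c); first by rewrite /= in_itv /= -E -lecR Rn normr_ge0.
  have := add_Re2_Im2 c; rewrite -Rn E -rmorphXn => /complexI /eqP.
  rewrite -subr_eq0 addrAC subrr add0r sqrf_eq0 => /eqP Im0.
  by rewrite [RHS]complexE Im0 mulr0 addr0.
(* The value of [D] comes from x + 1 <= |z - x| + (B + 1) and d <= 2 |z - x|. *)
move: (complex.Re `|b|) hb => B hb; exists B, (1 + 2 * (B + 1) / d) => z Kz.
have zK : z \in K by apply/mem_set.
have zb : `|z| <= B%:C by rewrite -Rn lecR hb.
split=> // x x0.
(* Write |z| - Re z = (|z| - x) - Re (z - x); each part is at most |z - x|. *)
have zx : d%:C <= 2 * `|z - x|.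
  apply: (@le_trans _ _ (complex.Re `|z| - complex.Re z)%:C); first by rewrite lecR hd.
  have xE : x = (complex.Re x)%:C by rewrite RRe_real// ger0_real.
  rewrite rmorphB /= Rn (_ : (complex.Re z)%:C = x + (complex.Re (z - x))%:C); last first.
    by rewrite Re_sub rmorphB /= -xE addrC subrK.
  rewrite opprD addrA mulr_natl mulr2n lerD//.
    by rewrite lerBlDr -{2}(ger0_norm x0) (le_trans _ (ler_normD _ _))// subrK.
  by rewrite -rmorphN (le_trans _ (normc_ge_Re _))// lecR -normrN ler_norm.
have dC : 0 < d%:C by rewrite ltcR.
rewrite rmorphD rmorphM fmorphV rmorphM rmorph_nat rmorphD !rmorph1 /=.
rewrite mulrDl mul1r.
have xz : x <= `|z - x| + `|z|.
  by rewrite -[leLHS]ger0_norm// distrC (le_trans _ (ler_normD _ _))// subrK.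
apply: (@le_trans _ _ (`|z - x| + (B%:C + 1))).
  by rewrite addrA lerD2r (le_trans xz)// lerD2l.
rewrite lerD2l [2 * _]mulrC -!mulrA ler_peMr ?addr_ge0 ?(le_trans _ zb)//.
by rewrite mulrCA mulrC ler_pdivlMr// mul1r.
Qed.

(** * The uniform asymptotics *)

Theorem proposition4p6 (R : realType) (m : nat) (alpha : R)
  (halpha : m%:R - 1 < alpha)
  (K : set R[i]^o) (cptK : compact K)
  (hK : K `<=` ~` [set x%:C | x in `[(0 : R), +oo[]) :
  exists M : R, \forall j \near \oo, forall z : R[i], K z ->
    `| - ((alpha + 1 + j%:R)^-1)%:C
         * (evalC (xlaguerreII alpha m j) z / evalC (laguerre alpha j) z)
       - evalC (eta_poly (alpha + 1) m) z |
    <= (M / Num.sqrt j%:R)%:C.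
Proof.
have a1 : -1 < alpha by apply: le_lt_trans halpha; rewrite lerBrDr addNr.
have [B [D hBD]] := compact_slit_plane_bounds cptK hK.
pose Q : {poly R[i]} := map_poly (real_complex R)
  ((alpha + 1) *: eta_poly (alpha + 1) m
   - (alpha + 1 - m%:R) *: eta_poly (alpha + 1 + 1) m).
have [c hc] := poly_disk_bound Q B%:C.
(* With s = sqrt j >= 1, the quotient is at most 1 + D s <= (1 + D) s, [Q] is at most Re c on the
   disk containing [K], and 1 / (alpha + 1 + j) <= 1 / s^2. *)
exists ((1 + D) * complex.Re c).
near=> j => z Kz.
have j0 : 0 < (j%:R : R) by rewrite ltr0n; near: j; exact: nbhs_infty_gt.
have [zB zD] := hBD z Kz.
have s1 : 1 <= Num.sqrt (j%:R : R) by rewrite -[leLHS]sqrtr1 ler_wsqrtr// ler1n -(ltr0n R).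
have Qc : `|Q.[z]| <= (complex.Re c)%:C.
  by have := hc z zB; rewrite lecE normc_def => /andP[_ h]; rewrite lecR.
have [y0 wy] : (laguerre alpha%:C j).[z] != 0 /\
    `|(laguerre (alpha%:C + 1) j).[z] / (laguerre alpha%:C j).[z]|
    <= 1 + D%:C * (Num.sqrt j%:R)%:C.
  apply: laguerre_quotient_bound => //; first by move: a1; rewrite -ltcR rmorphN1.
    by rewrite lecR sqrtr_ge0.
  by rewrite -rmorphXn sqr_sqrtr ?ler0n// rmorph_nat.
have d0 : 0 < alpha + 1 + j%:R.
  by rewrite addr_gt0// -ltrBlDr sub0r.
set E := (X in `|X|).
(* The main term of [xlaguerreII_eq] cancels the subtracted [eta_poly] value exactly, leaving only
   the quotient times [Q]. *)
have {E}-> : E = - ((alpha + 1 + j%:R)^-1)%:C *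
    ((laguerre (alpha%:C + 1) j).[z] / (laguerre alpha%:C j).[z] * Q.[z]).
  rewrite /E xlaguerreII_eq /evalC rmorphB rmorphM /= -/Q map_polyZ.
  rewrite rmorphM /= !map_laguerre /=.
  rewrite rmorphD rmorph1 !(hornerD, hornerN, hornerM, hornerZ).
  rewrite fmorphV /=.
  have dC0 : (alpha + 1 + j%:R)%:C != 0 by rewrite fmorph_eq0 gt_eqF.
  have field_id (F : fieldType) (t v q e y : F) : t != 0 -> y != 0 ->
      - t^-1 * ((v * q - t * (e * y)) / y) - e = - t^-1 * (v / y * q).
    by move=> t0 y1; field; rewrite t0 y1.
  exact: field_id.
move: (_ / _) wy => w wy.
have Dpos : 0 <= 1 + D%:C * (Num.sqrt j%:R)%:C by apply: le_trans wy.
have c0 : 0 <= complex.Re c by rewrite -ler0c (le_trans _ Qc).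
rewrite mulNr normrN !normrM ger0_norm ?ler0c ?invr_ge0 ?(ltW d0)//.
apply: (@le_trans _ _ (j%:R^-1 * ((1 + D * Num.sqrt j%:R) * complex.Re c))%:C).
  rewrite [leRHS]rmorphM [X in _ <= _ * X]rmorphM /=.
  rewrite ler_pM ?ler0c ?invr_ge0 ?(ltW d0) ?mulr_ge0//.
    by rewrite lecR lef_pV2 ?posrE// lerDr -lerBlDr sub0r ltW.
  by rewrite ler_pM// rmorphD rmorphM rmorph1.
rewrite lecR mulrCA [leRHS]mulrAC mulrA ler_wpM2r//.
set s := Num.sqrt _ in s1 *.
have -> : (j%:R : R) = s ^+ 2 by rewrite sqr_sqrtr ?ler0n.
have s0 : 0 < s by apply: lt_le_trans s1.
rewrite ler_pdivlMr// expr2 invfM mulrA mulrAC divfK ?gt_eqF//.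
rewrite ler_pdivrMr// mulrDl mul1r lerD//.
Unshelve. all: by end_near.
Qed.
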